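(* For a class $\mathcal C$ of finite ordered graphs the following are equivalent: (1) $\mathcal C$ has bounded twin-width; (2) $\sup_{G\in\mathcal C}\mathrm{fw}_r(G)<\infty$ for every $r\in\mathbb N$; (3) $\sup_{G\in\mathcal C}\mathrm{fw}_5(G)<\infty$; (4) $\sup_{G\in\mathcal C}\mathrm{fw}^<_r(G)<\infty$ for every $r\in\mathbb N$; (5) $\sup_{G\in\mathcal C}\mathrm{fw}^<_1(G)<\infty$.
   Context: An ordered graph $G=(V,E,<)$ consists of a finite simple undirected graph $(V,E)$ and a total order $<$ on $V$, viewed as a structure with the two binary relations $E$ and $<$. Twin-width: disjoint $A,B\subseteq V$ are homogeneous if (all pairs $a\in A,b\in B$ are $E$-adjacent or none are) and (either $a<b$ for all $a\in A,b\in B$ or $b<a$ for all such pairs). An uncontraction sequence is a sequence of partitions $\mathcal P_1,\dots,\mathcal P_n$ of $V$ from the one-part partition to singletons, each step splitting one part into two; the red graph of $\mathcal P_i$ joins distinct non-homogeneous parts; the twin-width is the least $d$ such that some uncontraction sequence has all red graphs of maximum degree at most $d$. Flips of binary structures: for a partition $\mathcal P$ of $V$, a $\mathcal P$-flip is specified by binary relations $E_F,<_F$ on $\mathcal P$ and replaces each relation $R\in\{E,<\}$ by $R\,\triangle\,\bigcup_{(P,Q)\in R_F}P\times Q$; a $k$-flip uses some $\mathcal P$ with $|\mathcal P|\le k$. The Gaifman graph of a structure joins distinct $u,v$ if $(u,v)$ or $(v,u)$ lies in some relation. Flipper game of radius $r$ and width $k$: $G_0=G$, runner chooses $v_0$;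 in round $i\ge1$ the flipper announces a $k$-flip $G_i$ of $G$, runner moves from $v_{i-1}$ to $v_i$ along a path of length at most $r$ in the Gaifman graph of $G_{i-1}$; flipper wins if $v_i$ is isolated in the Gaifman graph of $G_i$; $\mathrm{fw}_r(G)$ is the least $k$ for which the flipper wins. Ordered flip-width: a $k$-cut-flip of $G$ is a triple $(V,E',S)$ where $(V,E')$ is a $k$-flip of the graph $(V,E)$ (partition of $V$ into at most $k$ parts, inverting adjacency between distinct vertices of some pairs of possibly equal parts) and $S\subseteq V$, $|S|\le k$. Let $u\sim_S v$ iff $u=v$, or there is no $s\in S$ with $\min(u,v)\le s\le\max(u,v)$. The associated weighted graph has edges $uv$ ($u\neq v$) with $uv\in E'$ (weight $1$) or $u\sim_S v$ (weight $0$). In the ordered flipper game of radius $r$ and width $k$, in round $i\ge1$ the flipper announces a $k$-cut-flip $G_i$; in round $1$ the runner picks $v_1$ arbitrarily, and in round $i\ge2$ the runner moves from $v_{i-1}$ to $v_i$ along a path of total weight at most $r$ in the weighted graph of $G_{i-1}$; the flipper wins if $v_i$ is isolated in the weighted graph of $G_i$. $\mathrm{fw}^<_r(G)$ is the least $k$ for which the flipper has a winning strategy. *)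

(* Defs.v *)
From mathcomp Require Import all_boot.
Set Implicit Arguments. Unset Strict Implicit. Unset Printing Implicit Defensive.

(* A finite ordered graph, represented up to isomorphism: vertex set 'I_n,
   total order = natural order on 'I_n, E a simple (symmetric, irreflexive)
   adjacency relation. *)
Record ograph := OGraph {
  og_n : nat;
  og_E : rel 'I_og_n;
  og_sym : symmetric og_E;
  og_irr : irreflexive og_E }.

Definition olt n (u v : 'I_n) : bool := (nat_of_ord u < nat_of_ord v)%N.

Definition homog n (E : rel 'I_n) (A B : {set 'I_n}) : bool :=
  ([forall a in A, forall b in B, E a b] || [forall a in A, forall b in B, ~~ E a b])
  && ([forall a in A, forall b in B, olt a b] || [forall a in A, forall b in B, olt b a]).

Definition red_deg_le n (E : rel 'I_n) (P : {set {set 'I_n}}) (d : nat) : bool :=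
  [forall A in P, #|[set B in P | (B != A) && ~~ homog E A B]| <= d].

Definition split_step n (P Q : {set {set 'I_n}}) : Prop :=
  exists A B1 B2 : {set 'I_n},
    [/\ A \in P, B1 != set0, B2 != set0, [disjoint B1 & B2]
       & A = B1 :|: B2 /\ Q = (P :\ A) :|: [set B1; B2]].

Definition uncontraction_seq n (P0 : {set {set 'I_n}}) (s : seq {set {set 'I_n}}) : Prop :=
  [/\ #|P0| <= 1,
      all (fun P => partition P [set: 'I_n]) (P0 :: s),
      (forall i, i.+1 < size (P0 :: s) ->
         split_step (nth set0 (P0 :: s) i) (nth set0 (P0 :: s) i.+1))
    & (forall A, A \in last P0 s -> #|A| = 1)].

Definition tww_le (G : ograph) (d : nat) : Prop :=
  exists P0 s, uncontraction_seq P0 s /\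
    forall P, P \in P0 :: s -> red_deg_le (@og_E G) P d.

(* a binary structure on 'I_n: first component for E, second for < *)
Definition bstruct n := (rel 'I_n * rel 'I_n)%type.

Definition is_kflip n (E : rel 'I_n) (k : nat) (F : bstruct n) : Prop :=
  exists (p : 'I_n -> 'I_k) (EF LF : rel 'I_k),
    forall u v, F.1 u v = xorb (E u v) (EF (p u) (p v)) /\
                F.2 u v = xorb (olt u v) (LF (p u) (p v)).

Definition gaif n (F : bstruct n) : rel 'I_n :=
  fun u v => (u != v) && [|| F.1 u v, F.1 v u, F.2 u v | F.2 v u].

Fixpoint reach n (adj : rel 'I_n) (r : nat) (u v : 'I_n) : Prop :=
  match r with
  | 0 => u = v
  | r'.+1 => reach adj r' u v \/ exists w, adj u w /\ reach adj r' w v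
  end.

Definition isolated n (F : bstruct n) (v : 'I_n) : Prop := forall w, ~~ gaif F v w.

(* fwin E r k H v : the flipper (width k, radius r) wins from the position where
   the previous announced structure is H and the runner stands at v. *)
Inductive fwin n (E : rel 'I_n) (r k : nat) : bstruct n -> 'I_n -> Prop :=
| fwin_step (H : bstruct n) (v : 'I_n) (F : bstruct n) :
    is_kflip E k F ->
    (forall v', reach (gaif H) r v v' -> isolated F v' \/ fwin E r k F v') ->
    fwin E r k H v.

Definition flipper_wins (r k : nat) (G : ograph) : Prop :=
  forall v0 : 'I_(og_n G), fwin (@og_E G) r k (@og_E G, @olt (og_n G)) v0.

Definition fw_le (r : nat) (G : ograph) (K : nat) : Prop :=
  exists k, k <= K /\ flipper_wins r k G.

(* a cut-flip state: flipped edge relation E' and cut set S *)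
Definition cutstate n := (rel 'I_n * {set 'I_n})%type.

Definition is_kcutflip n (E : rel 'I_n) (k : nat) (C : cutstate n) : Prop :=
  (exists (p : 'I_n -> 'I_k) (F : rel 'I_k), symmetric F /\
     forall u v, C.1 u v = (u != v) && xorb (E u v) (F (p u) (p v)))
  /\ #|C.2| <= k.

Definition simS n (S : {set 'I_n}) (u v : 'I_n) : bool :=
  (u == v) ||
  [forall s in S, ~~ ((minn u v <= s) && (s <= maxn u v))].

Inductive wreach n (C : cutstate n) : nat -> 'I_n -> 'I_n -> Prop :=
| wr_refl r u : wreach C r u u
| wr_zero r u w v : u != w -> simS C.2 u w -> wreach C r w v -> wreach C r u v
| wr_one r u w v : u != w -> C.1 u w -> wreach C r w v -> wreach C r.+1 u v.

Definition wisolated n (C : cutstate n) (v : 'I_n) : Prop :=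
  forall w, w != v -> ~~ C.1 v w && ~~ C.1 w v && ~~ simS C.2 v w.

Inductive owin n (E : rel 'I_n) (r k : nat) : cutstate n -> 'I_n -> Prop :=
| owin_step (C : cutstate n) (v : 'I_n) (C' : cutstate n) :
    is_kcutflip E k C' ->
    (forall v', wreach C r v v' -> wisolated C' v' \/ owin E r k C' v') ->
    owin E r k C v.

Definition oflipper_wins (r k : nat) (G : ograph) : Prop :=
  exists C1, is_kcutflip (@og_E G) k C1 /\
    forall v1, wisolated C1 v1 \/ owin (@og_E G) r k C1 v1.

Definition ofw_le (r : nat) (G : ograph) (K : nat) : Prop :=
  exists k, k <= K /\ oflipper_wins r k G.

(* Main.v *)
Require Import Defs.
From mathcomp Require Import all_boot zify.
From Stdlib Require Import Classical.
Set Implicit Arguments. Unset Strict Implicit. Unset Printing Implicit Defensive.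

(** If the twin-width is at most [d], the flipper follows an uncontraction sequence:
    in the current partition, the parts near the runner in the red graph are few, and
    flipping each of them against the rest of the graph according to its homogeneous
    connections forces the runner to move along red edges; for cut-flips the order
    between these parts is cut at their extreme elements.  At the partition into
    singletons there are no red edges and the runner is isolated.

    A [k]-flip of the order with its [k] classes cut at their minima and maxima shows that
    the vertices of one interval are at distance at most 2 in the Gaifman graph, so a path
    of weight 1 becomes one of length at most 2 + 1 + 2 = 5: radius 5 for flips yields
    radius 1 for cut-flips.

    Conversely, call a set of vertices poor for a division into intervals if it has few
    distinct neighbourhoods outside the union of few intervals.  If no union of two
    consecutive intervals is poor, the runner survives at radius 1: whenever its uncut
    pair of intervals is about to be cut, some two vertices of the pair in the same flip
    class have different neighbourhoods away from the new cuts, and one of them leads to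
    an uncut pair.  So from the division into singletons consecutive intervals can be
    merged one after the other, all intervals staying poor.  Grouping the vertices of an
    interval by their neighbourhoods outside its exceptional intervals gives nested
    partitions of bounded red degree, and so does every partition in between. *)

(** * Images, blocks of partitions and relabelling *)

Section FiniteSets.

Lemma leq_card_imset_factor (aT rT sT : finType) (A : {set aT})
    (phi : aT -> rT) (psi : aT -> sT) :
  {in A &, forall u v, phi u = phi v -> psi u = psi v} ->
  #|psi @: A| <= #|phi @: A|.
Proof.
move=> fact; have [->|[x0 x0A]] := set_0Vmem A; first by rewrite !imset0 cards0.
pose g y := psi (odflt x0 [pick x in A | phi x == y]).
have -> : psi @: A = g @: (phi @: A).
  rewrite -imset_comp; apply: eq_in_imset => x xA; rewrite /g /=.
  case: pickP => [y /andP[yA /eqP e]|/(_ x)]; last by rewrite xA eqxx.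
  by apply: fact.
exact: leq_imset_card.
Qed.

Lemma leq_card_bigcup_const (I : Type) (T : finType) (r : seq I) (P : pred I)
    (F : I -> {set T}) c :
  (forall i, P i -> #|F i| <= c) ->
  #|\bigcup_(i <- r | P i) F i| <= count P r * c.
Proof.
move=> Fc; elim: r => [|i r IH]; first by rewrite big_nil cards0.
rewrite big_cons /=; case: ifP => Pi; rewrite ?add0n //= add1n mulSn.
apply: leq_trans (leq_card_setU _ _) _; apply: leq_add => //; exact: Fc.
Qed.

Lemma injection_to_ord (T : finType) k :
  #|T| <= k -> exists e : T -> 'I_k, injective e.
Proof.
move=> le; exists (fun x => widen_ord le (enum_rank x)) => x y e.
by apply: enum_rank_inj; apply/val_inj; exact: (congr1 val e).
Qed.

(** Colourings take values in arbitrary finite types, while the games ask for flips indexed by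
    ['I_k]; pairs outside the image of [e] are left unrelated. *)
Definition push_rel (T S : finType) (e : T -> S) (R : rel T) : rel S :=
  fun i j => [exists a, exists b, [&& e a == i, e b == j & R a b]].

Lemma push_relE (T S : finType) (e : T -> S) (R : rel T) a b :
  injective e -> push_rel e R (e a) (e b) = R a b.
Proof.
move=> inj; apply/existsP/idP => [[a' /existsP[b' /and3P[/eqP ea /eqP eb]]]|Rab].
  by rewrite (inj _ _ ea) (inj _ _ eb).
by exists a; apply/existsP; exists b; rewrite !eqxx.
Qed.

Lemma push_rel_sym (T S : finType) (e : T -> S) (R : rel T) :
  symmetric R -> symmetric (push_rel e R).
Proof.
move=> sR i j; apply/existsP/existsP => -[a /existsP[b /and3P[ea eb Rab]]];
  by exists b; apply/existsP; exists a; rewrite ea eb sR.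
Qed.

Lemma mem_pblock_setT (T : finType) (P : {set {set T}}) u v :
  partition P [set: T] -> (v \in pblock P u) = (pblock P u == pblock P v).
Proof.
move=> /and3P[/eqP cP tP _]; rewrite eq_pblock ?cP ?in_setT //.
Qed.

Lemma pblockT (T : finType) (P : {set {set T}}) u :
  partition P [set: T] -> u \in pblock P u.
Proof. by move=> pP; rewrite mem_pblock_setT. Qed.

Lemma pblockT_mem (T : finType) (P : {set {set T}}) u :
  partition P [set: T] -> pblock P u \in P.
Proof. by move=> /and3P[/eqP cP _ _]; rewrite pblock_mem // cP in_setT. Qed.

Lemma pblockT_def (T : finType) (P : {set {set T}}) A u :
  partition P [set: T] -> A \in P -> u \in A -> pblock P u = A.
Proof. by move=> /and3P[_ tP _] AP uA; apply: def_pblock. Qed.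

Lemma partition_ex (T : finType) (P : {set {set T}}) A :
  partition P [set: T] -> A \in P -> exists u, A = pblock P u.
Proof.
move=> pP AP; have [A0|[u uA]] := set_0Vmem A.
  by case/and3P: pP => _ _ /negP; rewrite -A0.
by exists u; rewrite (pblockT_def pP AP uA).
Qed.

Lemma partition_imset_pblock (T : finType) (P : {set {set T}}) :
  partition P [set: T] -> P = pblock P @: [set: T].
Proof.
move=> pP; apply/setP => A; apply/idP/imsetP => [/(partition_ex pP)[u ->]|[u _ ->]].
  by exists u.
exact: pblockT_mem.
Qed.

Lemma pblock_preim (T : finType) (rT : eqType) (phi : T -> rT) u v :
  (pblock (preim_partition phi [set: T]) u == pblock (preim_partition phi [set: T]) v)
  = (phi u == phi v).
Proof.
rewrite -mem_pblock_setT ?preim_partitionP //.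
by rewrite pblock_equivalence_partition ?in_setT // => x y z _ _ _; split=> // /eqP->.
Qed.

Definition finer (T : finType) (Q P : {set {set T}}) :=
  forall u v, pblock Q u = pblock Q v -> pblock P u = pblock P v.

End FiniteSets.

(** * Red neighbourhoods in a partition *)

Section Homogeneity.
Variables (n : nat) (E : rel 'I_n).
Implicit Types (A B X : {set 'I_n}) (P Q : {set {set 'I_n}}) (u v w : 'I_n).

Lemma homogE A B a a' b b' : homog E A B ->
  a \in A -> a' \in A -> b \in B -> b' \in B ->
  E a b = E a' b' /\ olt a b = olt a' b' /\ olt b a = olt b' a'.
Proof.
have all2 (R : rel 'I_n) : [forall x in A, forall y in B, R x y] ->
    forall x y, x \in A -> y \in B -> R x y.
  by move=> /forall_inP h x y /h /forall_inP; apply.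
case/andP=> hE hO aA a'A bB b'B; split.
  case/orP: hE => /all2 h; first by rewrite !h.
  by rewrite (negPf (h a b aA bB)) (negPf (h a' b' a'A b'B)).
case/orP: hO => /all2 h; have := h a b aA bB; have := h a' b' a'A b'B;
  by rewrite /olt; lia.
Qed.

Lemma homog_set1 a b : a != b -> homog E [set a] [set b].
Proof.
move=> ab.
have all2 (R : rel 'I_n) : [forall x in [set a], forall y in [set b], R x y] = R a b.
  apply/forall_inP/idP => [/(_ a (set11 _)) /forall_inP/(_ b (set11 _))//|Rab x].
  by rewrite inE => /eqP->; apply/forall_inP => y; rewrite inE => /eqP->.
rewrite /homog !all2; case: (E a b) => /=; rewrite /olt -neq_ltn;
  by apply: contraNneq ab => /val_inj ->.
Qed.

(** The reflexive closure of the red graph, lifted from parts to vertices, so that red balls are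
    sets of vertices. *)
Definition near P u w :=
  (pblock P u == pblock P w) || ~~ homog E (pblock P u) (pblock P w).

Definition nbhd P X := [set w | [exists u in X, near P u w]].

Lemma sub_nbhd P X : X \subset nbhd P X.
Proof.
by apply/subsetP => u uX; rewrite inE; apply/exists_inP; exists u; rewrite // /near eqxx.
Qed.

Lemma nbhd_mem P X u w : u \in X -> near P u w -> w \in nbhd P X.
Proof. by move=> uX nuw; rewrite inE; apply/exists_inP; exists u. Qed.

Lemma sub_iter_nbhd P X r : X \subset iter r (nbhd P) X.
Proof. by elim: r => //= r IH; apply: subset_trans IH (sub_nbhd _ _). Qed.

(** Each part met by [X] contributes itself and at most [d] red neighbours. *)
Lemma card_nbhd P X d : partition P [set: 'I_n] -> red_deg_le E P d ->
  #|pblock P @: nbhd P X| <= #|pblock P @: X| * d.+1.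
Proof.
move=> pP /forallP rP.
pose F A := A |: [set B in P | (B != A) && ~~ homog E A B].
apply: (@leq_trans #|\bigcup_(A in pblock P @: X) F A|).
  apply/subset_leq_card/subsetP => B /imsetP[w]; rewrite inE.
  case/exists_inP => u uX nuw ->; apply/bigcupP.
  exists (pblock P u); first exact: imset_f.
  rewrite !inE pblockT_mem //= eq_sym; case/orP: nuw => [->//|->].
  by case: eqP.
rewrite -[X in _ <= X * _]sum1_card sum1_count; apply: leq_card_bigcup_const => _ /imsetP[u _ ->].
apply: leq_trans (leq_card_setU _ _) _; rewrite cards1 ltnS.
by apply: (implyP (rP _)); exact: pblockT_mem.
Qed.

Lemma card_iter_nbhd P X d r : partition P [set: 'I_n] -> red_deg_le E P d ->
  #|pblock P @: iter r (nbhd P) X| <= #|pblock P @: X| * d.+1 ^ r.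
Proof.
move=> pP rP; elim: r => [|r IH]; first by rewrite muln1.
apply: leq_trans (card_nbhd _ pP rP) _.
by rewrite expnSr mulnA leq_mul2r IH orbT.
Qed.

End Homogeneity.

(** * Uncontraction sequences as an inductive predicate *)

Section Towers.
Variables (n : nat) (E : rel 'I_n) (d : nat).
Implicit Types (X Y : {set 'I_n}) (P Q : {set {set 'I_n}}) (u v w : 'I_n).

(** The tail of an uncontraction sequence from a given partition on; it can be extended at its
    coarse end. *)
Inductive tower : {set {set 'I_n}} -> Prop :=
| tower_last P : partition P [set: 'I_n] -> red_deg_le E P d ->
    (forall A, A \in P -> #|A| = 1) -> tower P
| tower_split P Q : partition P [set: 'I_n] -> red_deg_le E P d ->
    split_step P Q -> tower Q -> tower P.

Lemma tower_partition P : tower P -> partition P [set: 'I_n].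
Proof. by case. Qed.

(** As long as [P] and [Q] differ, some block [B] of [Q] lies properly inside a block [A] of [P].
    Splitting [A] into [B] and [A :\: B] stays between the two and lowers the number of blocks of
    [Q] missing from [P]. *)
Lemma tower_coarsen P Q :
  partition P [set: 'I_n] -> partition Q [set: 'I_n] -> finer Q P -> tower Q ->
  (forall R, partition R [set: 'I_n] -> finer R P -> finer Q R -> red_deg_le E R d) ->
  tower P.
Proof.
move=> + pQ + tQ.
have [m] := ubnP #|Q :\: P|; elim: m P => // m IH P cP pP QP red.
have redP : red_deg_le E P d by apply: red.
have [/forallP eqPQ|] := boolP [forall u, pblock P u == pblock Q u].
  rewrite (partition_imset_pblock pP) (eq_imset _ (fun u => eqP (eqPQ u))).
  by rewrite -partition_imset_pblock.
case/forallPn => u neq; set A := pblock P u in neq; set B := pblock Q u in neq.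
have uA : u \in A by exact: pblockT.
have uB : u \in B by exact: pblockT.
have BA v : v \in B -> v \in A.
  by rewrite !mem_pblock_setT // => /eqP/QP/eqP.
have AP : A \in P by exact: pblockT_mem.
have BQ : B \in Q by exact: pblockT_mem.
have inA v : v \in A -> pblock P v = A by apply: pblockT_def.
have [x xA xB] : exists2 x, x \in A & x \notin B.
  apply/subsetPn; apply: contra neq => AB; rewrite eqEsubset AB.
  by apply/subsetP => v /BA.
pose key v := (pblock P v, v \in B).
pose P' := preim_partition key [set: 'I_n].
have pP' : partition P' [set: 'I_n] by exact: preim_partitionP.
have mem' v w : (w \in pblock P' v) = (key v == key w).
  by rewrite mem_pblock_setT // pblock_preim.
have blockB v : v \in B -> pblock P' v = B.
  move=> vB; apply/setP => w; rewrite mem' /key xpair_eqE (inA v) ?BA // vB.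
  by case: (boolP (w \in B)) => [/BA/inA->|_]; rewrite ?eqxx ?andbF.
have blockD v : v \in A -> v \notin B -> pblock P' v = A :\: B.
  move=> vA vB; apply/setP => w; rewrite mem' /key xpair_eqE (inA v) // (negPf vB) inE.
  by rewrite eq_sym [false == _]eq_sym eqbF_neg andbC (mem_pblock_setT _ _ pP) eq_sym.
have blockO v : v \notin A -> pblock P' v = pblock P v.
  move=> vA; apply/setP => w; rewrite mem' mem_pblock_setT // /key xpair_eqE.
  have vB : v \notin B by apply: contra vA => /BA.
  rewrite (negPf vB); case: eqP => //= e; rewrite eq_sym eqbF_neg.
  apply: contra vA => /BA/inA; rewrite -e => e'.
  by rewrite -e' pblockT.
have step : split_step P P'.
  exists A, B, (A :\: B); split=> //.
  - by apply/set0Pn; exists u.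
  - by apply/set0Pn; exists x; rewrite inE xB.
  - by rewrite -setI_eq0; apply/eqP/setP => v; rewrite !inE; case: (v \in B).
  split.
    by apply/setP => v; rewrite !inE; case: (boolP (v \in B)) => //= /BA ->.
  apply/setP => Z; rewrite !inE; apply/idP/idP.
    move=> ZP'; have [v ->] := partition_ex pP' ZP'.
    have [vB|vB] := boolP (v \in B); first by rewrite blockB // eqxx orbT.
    have [vA|vA] := boolP (v \in A); first by rewrite blockD // eqxx !orbT.
    rewrite blockO // pblockT_mem // andbT; apply/orP; left.
    by apply: contra vA => /eqP <-; exact: pblockT.
  case/or3P => [/andP[ZA ZP]|/eqP->|/eqP->].
  - have [v Zv] := partition_ex pP ZP; rewrite Zv -blockO ?pblockT_mem //.
    by apply: contra ZA => /inA; rewrite Zv => ->.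
  - by rewrite -(blockB u) // pblockT_mem.
  - by rewrite -(blockD x) // pblockT_mem.
have P'P : finer P' P by move=> v w /eqP; rewrite pblock_preim => /eqP[].
apply: (tower_split pP redP step); apply: IH => //.
(* [B] becomes a block, and no block of [Q] is lost, since the only block removed, [A], is not one
   of [Q]. *)
- apply: leq_trans (cP : #|_| <= m); apply/proper_card/properP; split.
    apply/subsetP => Z; rewrite !inE => /andP[+ ZQ]; rewrite ZQ andbT.
    apply: contra => ZP; have [v Zv] := partition_ex pP ZP.
    have [vA|vA] := boolP (v \in A); last by rewrite Zv -blockO ?pblockT_mem.
    have ZA : Z = A by rewrite Zv inA.
    case/eqP: neq; rewrite -ZA; symmetry; apply: (pblockT_def pQ ZQ).
    by rewrite ZA.
  exists B; rewrite !inE BQ andbT; last by rewrite -(blockB u) // pblockT_mem.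
  apply/negP => BP; case/eqP: neq; exact: pblockT_def.
- move=> v w e; apply/eqP; rewrite pblock_preim /key (QP _ _ e) xpair_eqE eqxx /=.
  by rewrite !(mem_pblock_setT _ _ pQ) e.
- move=> R pR RP' QR; apply: red => // v w /RP'/P'P //.
Qed.

End Towers.

Lemma tww_leP G d :
  tww_le G d <-> exists2 P : {set {set 'I_(og_n G)}}, #|P| <= 1 & tower (@og_E G) d P.
Proof.
split=> [[P0 [s [[P1 all_part steps fin] red]]]|[P P1 tP]].
  exists P0 => //; elim: s P0 {P1} all_part steps fin red => [|Q s IH] P.
    move=> /= /andP[pP _] _ fin red; apply: tower_last => //.
    by apply: red; rewrite inE.
  move=> /andP[pP pQ] steps fin red; apply: (@tower_split _ _ _ _ Q) => //.
  - by apply: red; rewrite inE eqxx.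
  - by apply: (steps 0).
  - apply: IH => // [i|R Rs]; first exact: (steps i.+1).
    by apply: red; rewrite inE Rs orbT.
suff [s [ps steps fin red]] : exists s : seq {set {set 'I_(og_n G)}},
    [/\ all (fun P : {set {set 'I_(og_n G)}} => partition P [set: _]) (P :: s),
      (forall i, i.+1 < size (P :: s) ->
         split_step (nth set0 (P :: s) i) (nth set0 (P :: s) i.+1)),
      (forall A, A \in last P s -> #|A| = 1)
    & forall Q, Q \in P :: s -> red_deg_le (@og_E G) Q d].
  by exists P, s.
elim: tP => [{P1}P pP rP P1|{P1}P Q pP rP stepPQ tQ [s [ps steps fin red]]].
  exists [::]; split=> // [|Q]; first by rewrite /= pP.
  by rewrite inE => /eqP->.
exists (Q :: s); split=> // [|[|i]|R] //; first by apply/andP.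
  exact: (steps i).
by rewrite inE => /orP[/eqP->//|]; exact: red.
Qed.

(** * The strategy along a tower, for both games at once *)

Section AbstractGame.
Variables (n : nat) (E : rel 'I_n) (St : Type) (legal : St -> Prop) (adj : St -> rel 'I_n).
Variable r : nat.
Implicit Types (X Y : {set 'I_n}) (P Q : {set {set 'I_n}}) (u v w : 'I_n) (s : St).

Inductive game_win : St -> 'I_n -> Prop :=
| game_win_step s v s' : legal s' ->
    (forall v', reach (adj s) r v v' ->
       (forall w, ~~ adj s' v' w) \/ game_win s' v') ->
    game_win s v.

Lemma reach_refl (e : rel 'I_n) m u : reach e m u u.
Proof. by elim: m => [|m IH] //=; left. Qed.

(** Each step of the walk starts inside [X], where edges of [e] only join equal or red-adjacent
    parts. *)
Lemma reach_nbhd (e : rel 'I_n) P X m u v :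
  (forall x w, x \in X -> e x w -> near E P x w) -> 
  forall Y, u \in Y -> iter m (nbhd E P) Y \subset X ->
  reach e m u v -> v \in iter m (nbhd E P) Y.
Proof.
move=> eX; elim: m u => [|m IH] u Y uY YX /=; first by move=> <-.
case=> [ruv|[w [uw rwv]]].
  have sub := sub_nbhd E P (iter m (nbhd E P) Y).
  exact: (subsetP sub) (IH u Y uY (subset_trans sub YX) ruv).
rewrite -iterS iterSr; apply: (IH w) => //; last by rewrite -iterSr.
apply: (nbhd_mem uY); apply: eX => //; apply: (subsetP YX).
exact: (subsetP (sub_iter_nbhd E P Y m.+1)).
Qed.

Definition contains s P X := forall u w, u \in X -> adj s u w -> near E P u w.

Lemma card_pblock_split P Q X :
  partition P [set: 'I_n] -> partition Q [set: 'I_n] -> split_step P Q ->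
  #|pblock Q @: X| <= #|pblock P @: X| + 2.
Proof.
move=> pP pQ [A [B1 [B2 [_ _ _ _ [_ QE]]]]].
apply: (@leq_trans #|(pblock P @: X) :|: [set B1; B2]|).
  apply/subset_leq_card/subsetP => Z /imsetP[u uX Zu].
  have: Z \in Q by rewrite Zu pblockT_mem.
  rewrite QE !inE => /orP[/andP[_ ZP]|->]; last by rewrite orbT.
  apply/orP; left; apply/imsetP; exists u => //.
  by rewrite (pblockT_def pP ZP) // Zu pblockT.
by apply: leq_trans (leq_card_setU _ _) _; rewrite leq_add2l cards2; case: eqP.
Qed.

(** A red ball of radius [r] meets at most [d.+1 ^ r] parts, a split adds at most two, and enlarging
    by radius [r] in the next partition multiplies by [d.+1 ^ r]. *)
Definition tower_parts d := (d.+1 ^ r + 2) * d.+1 ^ r.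

(* The invariant confines the next move of the runner to the ball [B] of radius [r]
   in the red graph of [P]; the announced state must protect all positions reachable
   from [B] in the next partition [Q], which still meet few parts. *)
Lemma tower_game_win d :
  (forall s u, ~~ adj s u u) ->
  (forall P X, partition P [set: 'I_n] -> #|pblock P @: X| <= tower_parts d ->
     exists2 s, legal s & contains s P X) ->
  forall P, tower E d P -> forall s v,
  (forall v', reach (adj s) r v v' -> v' \in iter r (nbhd E P) [set v]) ->
  game_win s v.
Proof.
move=> adj_irr ex_legal P tP.
elim: tP => {P} [P pP rP P1|P Q pP rP stepPQ tQ IH] s v inv;
  have ball : #|pblock P @: iter r (nbhd E P) [set v]| <= d.+1 ^ r.
- by apply: leq_trans (card_iter_nbhd _ _ pP rP) _; rewrite imset_set1 cards1 mul1n.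
- have [|s' ls' cs'] := ex_legal P (iter r (nbhd E P) [set v]) pP.
    apply: leq_trans ball _; rewrite /tower_parts leq_pmull //; lia.
  (* Distinct singletons are homogeneous, so an edge at [v'] would have to be a loop. *)
  apply: (game_win_step ls') => v' /inv v'B; left => w; apply/negP => a.
  have single u : pblock P u = [set u].
    have /eqP/cards1P[x e] := P1 _ (pblockT_mem u pP).
    by have := pblockT u pP; rewrite e inE => /eqP ->.
  have vw : v' != w by apply: contraTneq a => ->; exact: adj_irr.
  have := cs' _ _ v'B a; rewrite /near !single homog_set1 // orbF.
  by move=> /eqP/set1_inj/eqP; rewrite (negPf vw).
- by apply: leq_trans (card_iter_nbhd _ _ pP rP) _; rewrite imset_set1 cards1 mul1n.
- have pQ := tower_partition tQ.
  have rQ : red_deg_le E Q d by case: tQ.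
  set B := iter r (nbhd E P) [set v] in inv ball.
  have [|s' ls' cs'] := ex_legal Q (iter r (nbhd E Q) B) pQ.
    apply: leq_trans (card_iter_nbhd _ _ pQ rQ) _; rewrite leq_mul2r; apply/orP; right.
    by apply: leq_trans (card_pblock_split _ pP pQ stepPQ) _; rewrite leq_add2r.
  apply: (game_win_step ls') => v' /inv v'B; right; apply: IH => w.
  apply: (reach_nbhd cs'); first by rewrite inE.
  elim: {w}r => [|m IHm] /=; first by rewrite sub1set.
  apply/subsetP => w; rewrite !inE => /exists_inP[x xm xw].
  by apply/exists_inP; exists x => //; exact: (subsetP IHm).
Qed.

End AbstractGame.

(** * Flips that erase homogeneous connections *)

Section IsolatingFlip.
Variables (n : nat) (E : rel 'I_n) (P : {set {set 'I_n}}) (X : {set 'I_n}).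
Hypothesis pP : partition P [set: 'I_n].

Definition met_part := {A : {set 'I_n} | A \in pblock P @: X}.

(** Towards a homogeneous part, related to some vertex means related to all, so this table is all
    that a flip has to know. *)
Definition trace (R : rel 'I_n) u : {ffun met_part -> bool * bool} :=
  [ffun A : met_part => ([exists x in sval A, R x u], [exists x in sval A, R u x])].

Definition colour := (option met_part * ({ffun met_part -> bool * bool} *
  {ffun met_part -> bool * bool}))%type.

Definition colour_of u : colour := (insub (pblock P u), (trace E u, trace (@olt n) u)).

(** Predicts the relation from colours: if one vertex lies in a met part [A], the table of the other
    at [A] gives the answer. *)
Definition guess (o1 o2 : option met_part) (t1 t2 : {ffun met_part -> bool * bool}) :=
  [exists A, ((o1 == Some A) && (t2 A).1) || ((o2 == Some A) && (t1 A).2)].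

(** The conjunction of both directions forces symmetry on all colours, including those that no
    vertex has. *)
Definition flip_E : rel colour := fun c1 c2 =>
  guess c1.1 c2.1 c1.2.1 c2.2.1 && guess c2.1 c1.1 c2.2.1 c1.2.1.

Definition flip_lt : rel colour := fun c1 c2 => guess c1.1 c2.1 c1.2.2 c2.2.2.

Lemma flip_E_sym : symmetric flip_E.
Proof. by move=> c1 c2; rewrite /flip_E andbC. Qed.

(** There are [m.+1] choices for the optional part and [4 ^ m] for each of the two tables. *)
Lemma card_colour m : #|pblock P @: X| <= m -> #|{: colour}| <= m.+1 * 16 ^ m.
Proof.
move=> le; rewrite !card_prod card_option !card_ffun card_prod card_bool card_sig.
have -> : #|[pred x | x \in pblock P @: X]| = #|pblock P @: X| by apply: eq_card.
rewrite -expnMn; apply: leq_mul; first by rewrite ltnS.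
by rewrite leq_exp2l.
Qed.

(** One of the two parts is met, so some clause of [guess] applies; as [R] is constant between the
    parts, every applicable clause returns [R u w]. *)
Lemma guess_homog (R : rel 'I_n) u w :
  (forall x y, x \in pblock P u -> y \in pblock P w -> R x y = R u w) ->
  (u \in X) || (w \in X) ->
  guess (insub (pblock P u)) (insub (pblock P w)) (trace R u) (trace R w) = R u w.
Proof.
move=> hR uwX.
have own x (A : met_part) : insub (pblock P x) == Some A -> val A = pblock P x.
  by case: insubP => //= B _ BE /eqP[<-].
have ex1 : [exists x in pblock P u, R x w] = R u w.
  apply/exists_inP/idP => [[x xu]|]; first by rewrite hR ?pblockT.
  by exists u; rewrite ?pblockT.
have ex2 : [exists x in pblock P w, R u x] = R u w.
  apply/exists_inP/idP => [[x xw]|]; first by rewrite hR ?pblockT.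
  by exists w; rewrite ?pblockT.
apply/existsP/idP => [[A]|Ruw].
  rewrite !ffunE /=; case/orP => /andP[/own ->]; first by rewrite ex1.
  by rewrite ex2.
case/orP: uwX => xX.
- have L : pblock P u \in pblock P @: X by apply: imset_f.
  exists (exist (fun A => A \in pblock P @: X) _ L : met_part); rewrite ffunE /= ex1 Ruw andbT.
  by rewrite insubT eqxx.
- have L : pblock P w \in pblock P @: X by apply: imset_f.
  exists (exist (fun A => A \in pblock P @: X) _ L : met_part).
  rewrite !ffunE /= ex2 Ruw andbT orbC.
  by rewrite insubT eqxx.
Qed.

Lemma flip_far u w : symmetric E -> u \in X -> ~~ near E P u w ->
  [/\ flip_E (colour_of u) (colour_of w) = E u w,
      flip_lt (colour_of u) (colour_of w) = olt u w
    & flip_lt (colour_of w) (colour_of u) = olt w u].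
Proof.
move=> sE uX; rewrite /near negb_or negbK => /andP[_ h].
have hh x y : x \in pblock P u -> y \in pblock P w ->
    E x y = E u w /\ olt x y = olt u w /\ olt y x = olt w u.
  by move=> xu yw; apply: (homogE h) => //; exact: pblockT.
have gE : guess (insub (pblock P u)) (insub (pblock P w)) (trace E u) (trace E w) = E u w.
  by apply: guess_homog => [x y xu yw|]; [have [] := hh x y xu yw | rewrite uX].
have gE' : guess (insub (pblock P w)) (insub (pblock P u)) (trace E w) (trace E u) = E u w.
  rewrite guess_homog => [|y x yw xu|]; rewrite ?uX ?orbT // sE //.
  by rewrite [RHS]sE; have [] := hh x y xu yw.
have gL : guess (insub (pblock P u)) (insub (pblock P w)) (trace (@olt n) u) (trace (@olt n) w)
    = olt u w.
  by apply: guess_homog => [x y xu yw|]; [have [_ []] := hh x y xu yw | rewrite uX].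
have gL' : guess (insub (pblock P w)) (insub (pblock P u)) (trace (@olt n) w) (trace (@olt n) u)
    = olt w u.
  by apply: guess_homog => [y x yw xu|]; [have [_ []] := hh x y xu yw | rewrite uX orbT].
by rewrite /flip_E /flip_lt /= gE gE' gL gL' andbb.
Qed.

End IsolatingFlip.

(** * Flips indexed by colours *)

Section FlipsFromColourings.
Variables (n : nat) (E : rel 'I_n) (k : nat) (T : finType) (p : 'I_n -> T).
Hypothesis cardT : #|T| <= k.

Lemma is_kflip_colouring (EF LF : rel T) :
  is_kflip E k (fun u v => xorb (E u v) (EF (p u) (p v)),
                fun u v => xorb (olt u v) (LF (p u) (p v))).
Proof.
have [e inj] := injection_to_ord cardT.
by exists (e \o p), (push_rel e EF), (push_rel e LF) => u v; rewrite /= !push_relE.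
Qed.

Lemma is_kcutflip_colouring (F : rel T) (S : {set 'I_n}) :
  symmetric F -> #|S| <= k ->
  is_kcutflip E k (fun u v => (u != v) && xorb (E u v) (F (p u) (p v)), S).
Proof.
move=> sF cS; have [e inj] := injection_to_ord cardT; split=> //.
exists (e \o p), (push_rel e F); split=> [|u v]; first exact: push_rel_sym.
by rewrite /= push_relE.
Qed.

End FlipsFromColourings.

(** * Cuts at extreme elements and weighted paths *)

Section Cuts.
Variables (n : nat).
Implicit Types (u v w x : 'I_n) (S : {set 'I_n}).

Lemma simSP S u v :
  reflect (u = v \/ forall s, s \in S -> ~ (minn u v <= s <= maxn u v)) (simS S u v).
Proof.
apply: (iffP orP) => -[/eqP|h]; [by left| |by move=> ->; left|].
  by right=> s sS; apply/negP; move/forall_inP: h; apply.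
by right; apply/forall_inP => s /h /negP.
Qed.

Lemma simS_refl S u : simS S u u.
Proof. by rewrite /simS eqxx. Qed.

Lemma simS_trans S u v w : simS S u v -> simS S v w -> simS S u w.
Proof.
case/simSP => [->//|huv] /simSP[<-|hvw]; apply/simSP; right=> // s sS.
have := huv s sS; have := hvw s sS; lia.
Qed.

Definition extremes (T : finType) (q : 'I_n -> T) (L : {set T}) : {set 'I_n} :=
  [set x | (q x \in L) && [forall y : 'I_n, (q y == q x) ==> (y <= x)]] :|:
  [set x | (q x \in L) && [forall y : 'I_n, (q y == q x) ==> (x <= y)]].

Lemma card_extremes (T : finType) (q : 'I_n -> T) L : #|extremes q L| <= 2 * #|L|.
Proof.
have half (R : rel nat) : (forall a b, R a b -> R b a -> a = b) ->
    #|[set x | (q x \in L) && [forall y : 'I_n, (q y == q x) ==> R y x]]| <= #|L|.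
  move=> anti; rewrite -(card_in_imset (f := q)).
    by apply/subset_leq_card/subsetP => _ /imsetP[x + ->]; rewrite inE => /andP[].
  move=> x y; rewrite !inE => /andP[_ /forallP hx] /andP[_ /forallP hy] e.
  apply/val_inj/anti.
    by have := hy x; rewrite e eqxx.
  by have := hx y; rewrite e eqxx.
rewrite mul2n -addnn; apply: leq_trans (leq_card_setU _ _) _.
apply: leq_add; first by apply: (half leq) => a b; lia.
by apply: (half geq) => a b; rewrite /=; lia.
Qed.

(** The minimum and maximum of the class of [u] are cuts, so neither lies between [u] and [w]; they
    surround [u], hence also [w]. *)
Lemma extremes_squeeze (T : finType) (q : 'I_n -> T) (L : {set T}) u w :
  q u \in L -> u != w -> simS (extremes q L) u w ->
  exists lo hi, [/\ q lo = q u, q hi = q u,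
                   (lo < u) && (lo < w) & (u < hi) && (w < hi)].
Proof.
move=> uL uw /simSP[/eqP|cut]; first by rewrite (negPf uw).
have [hi /eqP qhi hmax] := @arg_maxnP _ u (fun x => q x == q u) val (eqxx _).
have [lo /eqP qlo hmin] := @arg_minnP _ u (fun x => q x == q u) val (eqxx _).
exists lo, hi; split=> //.
- have loS : lo \in extremes q L.
    rewrite !inE qlo uL /=; apply/orP; right.
    by apply/forallP => y; apply/implyP => /hmin.
  have := cut _ loS; have := hmin u (eqxx _); rewrite /=; lia.
- have hiS : hi \in extremes q L.
    rewrite !inE qhi uL /=; apply/orP; left.
    by apply/forallP => y; apply/implyP => /hmax.
  have := cut _ hiS; have := hmax u (eqxx _); rewrite /=; lia.
Qed.

(** Forgets the weights, so that cut-flips become states of the abstract game. *)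
Definition wadj (C : cutstate n) : rel 'I_n :=
  fun u w => (u != w) && [|| C.1 u w, C.1 w u | simS C.2 u w].

Lemma wisolatedP C v : wisolated C v <-> forall w, ~~ wadj C v w.
Proof.
split=> h w.
  rewrite /wadj; case: (eqVneq v w) => //= vw; rewrite eq_sym in vw.
  by have /andP[/andP[/negPf-> /negPf->] ->] := h w vw.
by move=> wv; have := h w; rewrite /wadj eq_sym wv /= !negb_or andbA.
Qed.

Lemma reach_trans (e : rel 'I_n) a b u v w :
  reach e a u v -> reach e b v w -> reach e (a + b) u w.
Proof.
elim: a u => [|a IH] u /=; first by move=> ->.
case=> [ruv|[x [ux rxv]]] rvw; first by left; apply: IH.
by right; exists x; split=> //; apply: IH.
Qed.

(* Consecutive steps of weight 0 compose to a single one, so a path of weight [r]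
   alternates at most [r] unit steps with at most [r + 1] steps inside a class. *)
Lemma wreach_reach (e : rel 'I_n) (C : cutstate n) a r u v :
  (forall x y, simS C.2 x y -> reach e a x y) ->
  (forall x y, x != y -> C.1 x y -> e x y) ->
  wreach C r u v -> reach e (a.+1 * r + a) u v.
Proof.
move=> e0 e1 Wuv.
suff: forall u0, simS C.2 u0 u -> reach e (a.+1 * r + a) u0 v.
  by apply; exact: simS_refl.
elim: Wuv => {r u v} [r u|r u w v _ uw _ IH|r u w v nuw uw _ IH] u0 u0u.
- by rewrite addnC; apply: reach_trans (e0 _ _ u0u) (reach_refl _ _ _).
- exact: IH (simS_trans u0u uw).
- have -> : a.+1 * r.+1 + a = a + (1 + (a.+1 * r + a)) by rewrite mulnS; lia.
  apply: reach_trans (e0 _ _ u0u) _; apply: (@reach_trans _ 1 _ _ w).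
    by right; exists w; split=> //; exact: e1.
  exact: IH (simS_refl _ _).
Qed.

End Cuts.

(** * Induction on winning strategies *)

Section GameInduction.
Variable n : nat.
Implicit Types (v w : 'I_n).

(** The recursive occurrence sits under a disjunction, where the generated principle offers no
    induction hypothesis. *)
Lemma game_win_nested_ind (St : Type) (legal : St -> Prop) (adj : St -> rel 'I_n) r
    (Q : St -> 'I_n -> Prop) :
  (forall s v s', legal s' ->
     (forall v', reach (adj s) r v v' -> (forall w, ~~ adj s' v' w) \/ Q s' v') ->
     Q s v) ->
  forall s v, game_win legal adj r s v -> Q s v.
Proof.
move=> step; fix IH 3 => s v [{}s {}v s' ls' h].
by apply: (step s v s' ls') => v' /h [|g]; [left|right; exact: IH].
Qed.

Lemma fwin_nested_ind (E : rel 'I_n) r k (Q : bstruct n -> 'I_n -> Prop) :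
  (forall H v F, is_kflip E k F ->
     (forall v', reach (gaif H) r v v' -> isolated F v' \/ Q F v') -> Q H v) ->
  forall H v, fwin E r k H v -> Q H v.
Proof.
move=> step; fix IH 3 => H v [{}H {}v F lF h].
by apply: (step H v F lF) => v' /h [|g]; [left|right; exact: IH].
Qed.

Lemma owin_nested_ind (E : rel 'I_n) r k (Q : cutstate n -> 'I_n -> Prop) :
  (forall C v C', is_kcutflip E k C' ->
     (forall v', wreach C r v v' -> wisolated C' v' \/ Q C' v') -> Q C v) ->
  forall C v, owin E r k C v -> Q C v.
Proof.
move=> step; fix IH 3 => C v [{}C {}v C' lC h].
by apply: (step C v C' lC) => v' /h [|g]; [left|right; exact: IH].
Qed.

End GameInduction.

(** * Bounded twin-width makes the flipper win *)

Section BoundedTwinWidth.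
Variables (n : nat) (E : rel 'I_n).
Hypothesis sE : symmetric E.
Implicit Types (P : {set {set 'I_n}}) (X : {set 'I_n}) (u v w : 'I_n).

Definition flip_size m := m.+1 * 16 ^ m.

Lemma containing_kflip P X m : partition P [set: 'I_n] -> #|pblock P @: X| <= m ->
  exists2 F, is_kflip E (flip_size m) F & contains E (@gaif n) F P X.
Proof.
move=> pP cX; have cT := card_colour cX.
eexists; first exact: (is_kflip_colouring E (colour_of E P X) cT (@flip_E _ P X) (@flip_lt _ P X)).
move=> u w uX; apply: contraTT => far; have [e1 e2 e3] := flip_far pP sE uX far.
rewrite /gaif /= e1 e2 e3 flip_E_sym e1 [E w u]sE.
by case: (E u w); case: (olt u w); case: (olt w u); rewrite andbF.
Qed.

Lemma containing_kcutflip P X m : partition P [set: 'I_n] -> #|pblock P @: X| <= m ->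
  exists2 C, is_kcutflip E (flip_size m) C & contains E (@wadj n) C P X.
Proof.
move=> pP cX; have cT := card_colour cX.
set S := extremes (pblock P) (pblock P @: X).
have cS : #|S| <= flip_size m.
  apply: leq_trans (card_extremes _ _) _; apply: (@leq_trans (2 * m)).
    by rewrite leq_mul2l cX.
  rewrite /flip_size; case: m {cX cT} => // m; rewrite mulnC; apply: leq_mul => //.
  by rewrite expnS; apply: (@leq_trans 16); rewrite // leq_pmulr // expn_gt0.
eexists.
  exact: (is_kcutflip_colouring E (colour_of E P X) cT (@flip_E_sym _ P X) cS).
move=> u w uX; apply: contraTT => far; have [e1 _ _] := flip_far pP sE uX far.
rewrite /wadj /= e1 flip_E_sym e1 [E w u]sE.
case: (eqVneq u w) => //= uw.
have -> : xorb (E u w) (E u w) = false by case: (E u w).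
apply/negP => /=.
(* An uncut pair would put [w] strictly between two vertices of the part of [u], against homogeneity
   of the order. *)
case/(extremes_squeeze (imset_f _ uX) uw) => lo [hi [elo ehi /andP[_ lo_w] /andP[_ w_hi]]].
move: far; rewrite /near negb_or negbK => /andP[_ h].
have loA : lo \in pblock P u by rewrite mem_pblock_setT // elo.
have hiA : hi \in pblock P u by rewrite mem_pblock_setT // ehi.
have [_ []] := homogE h loA hiA (pblockT w pP) (pblockT w pP).
by rewrite /olt lo_w; lia.
Qed.

End BoundedTwinWidth.

Lemma one_part_nbhd n (E : rel 'I_n) (e : rel 'I_n) P r v v' :
  partition P [set: 'I_n] -> #|P| <= 1 ->
  reach e r v v' -> v' \in iter r (nbhd E P) [set v].
Proof.
move=> pP P1; apply: (@reach_nbhd _ _ _ _ setT) => [x w _ _||].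
- by apply/orP; left; apply/eqP; have := card_le1_eqP P1; apply; exact: pblockT_mem.
- by rewrite inE.
- exact: subsetT.
Qed.

Lemma tww_fw G d r : tww_le G d -> fw_le r G (flip_size (tower_parts r d)).
Proof.
case/tww_leP => P P1 tP; eexists; split; first exact: leqnn.
move=> v0; have pP := tower_partition tP.
have win : game_win (is_kflip (@og_E G) (flip_size (tower_parts r d))) (@gaif _) r
    (@og_E G, @olt _) v0.
  apply: (tower_game_win _ _ tP) => [s u|Q X pQ cX|v' ]; first by rewrite /gaif eqxx.
    exact: containing_kflip (@og_sym G) _ _ _ pQ cX.
  exact: one_part_nbhd.
elim/game_win_nested_ind: win => s v s' ls' h.
by apply: (fwin_step ls') => v' /h.
Qed.

(** A path of weight [r] turns into at most [r] unit steps and [r + 1] steps of weight 0, all edges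
    of [wadj]; hence the radius [2 * r + 1]. *)
Lemma tww_ofw G d r : tww_le G d -> ofw_le r G (flip_size (tower_parts (2 * r + 1) d)).
Proof.
case/tww_leP => P P1 tP; eexists; split; first exact: leqnn.
have pP := tower_partition tP; set k := flip_size _.
(* Any legal first announcement will do: with at most one part, the invariant holds for every
   state. *)
have [C0 lC0 _] := @containing_kcutflip _ _ (@og_sym G) P set0
  (tower_parts (2 * r + 1) d) pP ltac:(by rewrite imset0 cards0).
exists C0; split=> // v0; right.
have win : game_win (is_kcutflip (@og_E G) k) (@wadj _) (2 * r + 1) C0 v0.
  apply: (tower_game_win _ _ tP) => [s u|Q X pQ cX|v' ]; first by rewrite /wadj eqxx.
    exact: containing_kcutflip (@og_sym G) _ _ _ pQ cX.
  exact: one_part_nbhd.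
elim/game_win_nested_ind: win => s v s' ls' h.
apply: (owin_step ls') => v' vv'; have [] := h v'; last by right.
  apply: wreach_reach vv' => x y.
    by case: (eqVneq x y) => [->|xy xSy]; [left|right; exists y; rewrite /wadj xy xSy !orbT].
  by move=> xy Exy; rewrite /wadj xy Exy.
by move=> /wisolatedP; left.
Qed.

(** * From flips of radius 5 to cut-flips of radius 1 *)

Section FlipsToCuts.
Variables (n : nat) (E : rel 'I_n) (k : nat).
Hypotheses (sE : symmetric E).
Implicit Types (u v w : 'I_n) (F : bstruct n).

(* Every class of [p] is a clique of the Gaifman graph of the flip; two classes are
   completely adjacent unless exactly one of the two orders is flipped, in which case
   the maximum or the minimum of the class of [u] is a common neighbour. *)
Lemma cut_class_reach F (p : 'I_n -> 'I_k) (LF : rel 'I_k) u w :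
  (forall x y, F.2 x y = xorb (olt x y) (LF (p x) (p y))) ->
  simS (extremes p setT) u w -> reach (gaif F) 2 u w.
Proof.
move=> hF; case: (eqVneq u w) => [-> _|uw Suw]; first exact: reach_refl.
have [lo [hi [plo phi /andP[lo_u lo_w] /andP[u_hi w_hi]]]] :=
  extremes_squeeze (in_setT _) uw Suw.
have adj x y : x != y -> F.2 x y || F.2 y x -> gaif F x y.
  by rewrite /gaif => -> /= /orP[] ->; rewrite !orbT.
have neq (x y : 'I_n) : x < y -> x != y by move=> xy; apply: contraTneq xy => ->; rewrite ltnn.
case: (boolP (gaif F u w)) => [uw'|nuw]; first by right; exists w; split=> //; left.
have {nuw} : ~~ (F.2 u w || F.2 w u) by apply: contra nuw; exact: adj.
rewrite !hF /olt => nuw.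
have [ltuw|ltwu] : (u < w \/ w < u).
  by move: uw; rewrite neq_ltn => /orP.
- right; exists hi; split; last first.
    right; exists w; split=> //; apply: adj; first by rewrite eq_sym neq.
    rewrite !hF phi /olt w_hi; move: nuw; rewrite ltuw.
    have -> : (w < u) = false by lia.
    have -> : (hi < w) = false by lia.
    by case: (LF _ _); case: (LF _ _).
  apply: adj; first exact: neq.
  rewrite !hF phi /olt u_hi; have -> : (hi < u) = false by lia.
  by case: (LF _ _).
- right; exists lo; split; last first.
    right; exists w; split=> //; apply: adj; first exact: neq.
    rewrite !hF plo /olt lo_w; move: nuw; rewrite ltwu.
    have -> : (u < w) = false by lia.
    have -> : (w < lo) = false by lia.
    by case: (LF _ _); case: (LF _ _).
  apply: adj; first by rewrite eq_sym neq.
  rewrite !hF plo /olt lo_u; have -> : (u < lo) = false by lia.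
  by case: (LF _ _).
Qed.

Lemma kflip_kcutflip F : is_kflip E k F ->
  exists2 C, is_kcutflip E (2 * k) C
    & (forall x y, simS C.2 x y -> reach (gaif F) 2 x y) /\
      (forall x y, x != y -> C.1 x y || C.1 y x -> gaif F x y).
Proof.
case=> p [EF [LF hF]].
(* [EF] may be asymmetric; [F'] keeps one direction for each pair of classes, and an edge in either
   direction is a Gaifman edge. *)
pose F' : rel 'I_k := fun i j => if i <= j then EF i j else EF j i.
have sF' : symmetric F'.
  move=> i j; rewrite /F'; case: (ltngtP i j) => // e.
  by rewrite (val_inj e).
have cT : #|{: 'I_k}| <= 2 * k by rewrite card_ord leq_pmull.
have cS : #|extremes p [set: 'I_k]| <= 2 * k.
  by apply: leq_trans (card_extremes _ _) _; rewrite cardsT card_ord.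
eexists; first exact: (is_kcutflip_colouring E p cT sF' cS).
split=> [x y|x y xy] /=.
  by apply: (cut_class_reach (LF := LF)) => u v; have [] := hF u v.
rewrite [y == x]eq_sym xy sF' [E y x]sE orbb /gaif xy /= /F'.
have [-> _] := hF x y; have [-> _] := hF y x; rewrite [E y x]sE.
by case: ifP => _ /= ->; rewrite ?orbT.
Qed.

Lemma isolated_wisolated F (C : cutstate n) v :
  (forall x y, simS C.2 x y -> reach (gaif F) 2 x y) ->
  (forall x y, x != y -> C.1 x y || C.1 y x -> gaif F x y) ->
  isolated F v -> wisolated C v.
Proof.
move=> h0 h1 iso w wv; rewrite -!negb_or -orbA; apply/negP.
have vw : v != w by rewrite eq_sym.
rewrite orbA => /orP[/(h1 v w vw)|/h0]; first by rewrite (negPf (iso w)).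
have no x : ~ gaif F v x by apply/negP; exact: iso.
by case=> [[e|[x [/no]]]|[x [/no]]] //; rewrite e eqxx in wv.
Qed.

Lemma fwin_owin H v : fwin E 5 k H v -> forall C,
  (forall v', wreach C 1 v v' -> reach (gaif H) 5 v v') -> owin E 1 (2 * k) C v.
Proof.
move=> win; elim/fwin_nested_ind: win => {v}H v F lF IH C inv.
have [C' lC' [h0 h1]] := kflip_kcutflip lF.
apply: (owin_step lC') => v' /inv/IH[iso|win]; [left|right].
  exact: isolated_wisolated iso.
apply: win => w; apply: (wreach_reach (a := 2)) => // x y xy C'xy.
by apply: h1; rewrite // C'xy.
Qed.

End FlipsToCuts.

Lemma fw5_ofw1 G K : fw_le 5 G K -> ofw_le 1 G (2 * K).
Proof.
case=> k [kK win]; exists (2 * k); split; first by rewrite leq_mul2l kK.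
have [v0|no_vertex] := pickP (fun _ : 'I_(og_n G) => true); last first.
    exists (@og_E G, set0); split=> [|v]; last by have := no_vertex v.
  split; last by rewrite cards0.
  have no (u : 'I_(og_n G)) : 'I_(2 * k) by have := no_vertex u.
  by exists no, (fun _ _ => false); split=> // u; have := no_vertex u.
have [F lF win0] : exists2 F, is_kflip (@og_E G) k F & forall v',
    reach (gaif (@og_E G, @olt (og_n G))) 5 v0 v' ->
    isolated F v' \/ fwin (@og_E G) 5 k F v'.
  by case: (win v0) => H v F; exists F.
have [C lC [h0 h1]] := kflip_kcutflip (@og_sym G) lF.
exists C; split=> // v1.
have [|iso|w] := win0 v1; [|by left; exact: isolated_wisolated iso|right].
  (* The order makes the initial Gaifman graph complete, so one move simulates the free choice of
     [v1]. *)
  case: (eqVneq v0 v1) => [->|v01]; first exact: reach_refl.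
  right; exists v1; split; last exact: reach_refl.
  rewrite /gaif v01 /= /olt; move: v01; rewrite neq_ltn => /orP[->|->];
    by rewrite !orbT.
apply: (fwin_owin (@og_sym G) w) => v2; apply: (wreach_reach (a := 2)) => // x y xy Cxy.
by apply: h1; rewrite // Cxy.
Qed.

(** * Poor intervals, nested partitions and their red degree *)

Section RowCounts.
Variables (n : nat) (E : rel 'I_n).
Hypothesis sE : symmetric E.
Implicit Types (A B : {set 'I_n}) (Q : pred 'I_n) (u v w : 'I_n) (f g : 'I_n -> nat).

Definition row Q u := [set w | E u w && Q w].

Definition nrows A Q := #|row Q @: A|.

Lemma row_eqP Q u v : row Q u = row Q v <-> forall w, Q w -> E u w = E v w.
Proof.
split=> [/setP h w Qw|h]; first by have := h w; rewrite !inE Qw !andbT.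
by apply/setP => w; rewrite !inE; case Qw: (Q w); rewrite ?andbF // h.
Qed.

Lemma leq_nrows A B Q Q' : A \subset B -> (forall w, Q w -> Q' w) ->
  nrows A Q <= nrows B Q'.
Proof.
move=> AB QQ'; apply: (@leq_trans (nrows A Q')); last exact/subset_leq_card/imsetS.
apply: leq_card_imset_factor => u v _ _ /row_eqP h.
by apply/row_eqP => w /QQ'; exact: h.
Qed.

Lemma nrows_or A Q Q' : nrows A (predU Q Q') <= nrows A Q * nrows A Q'.
Proof.
rewrite /nrows -cardsX; apply: (@leq_trans #|(fun u => (row Q u, row Q' u)) @: A|).
  apply: leq_card_imset_factor => u v _ _ [/row_eqP h /row_eqP h'].
  by apply/row_eqP => w /orP[/h|/h'].
by apply/subset_leq_card/subsetP => _ /imsetP[u uA ->]; rewrite in_setX !imset_f.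
Qed.

(** The row over [A] of a vertex [w] of [B] is determined by the set of rows of [A] over [B] that
    contain [w]. *)
Lemma nrows_transpose A B : nrows B (mem A) <= 2 ^ nrows A (mem B).
Proof.
rewrite {2}/nrows -card_powerset.
pose types w := [set r in row (mem B) @: A | w \in r].
apply: (@leq_trans #|types @: B|); last first.
  apply/subset_leq_card/subsetP => _ /imsetP[w _ ->]; rewrite inE.
  by apply/subsetP => r; rewrite inE => /andP[].
apply: leq_card_imset_factor => u v uB vB /setP h; apply/row_eqP => w wA.
have := h (row (mem B) w); rewrite !inE imset_f //= uB vB !andbT sE => ->.
by rewrite sE.
Qed.

Definition poor K f A :=
  exists2 R : seq nat, size R <= K & nrows A (fun w => f w \notin R) <= K.

Definition fib f (i : nat) := [set u | f u == i].

(* With the threshold [2 ^ K], fibres outside the exceptional set of a poor fibre are not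
   bad in either direction.  Unlike such a set, badness is canonical and monotone when
   fibres are merged, which is what makes the partitions [sigpart] nested. *)
Definition bad K f i j :=
  (2 ^ K < nrows (fib f i) (mem (fib f j))) || (2 ^ K < nrows (fib f j) (mem (fib f i))).

Definition good_at K f i : pred 'I_n := fun w => ~~ bad K f i (f w).

Definition sig K f u := (f u, row (good_at K f (f u)) u).

Definition sigpart K f := preim_partition (sig K f) [set: 'I_n].

Lemma bad_sym K f i j : bad K f i j = bad K f j i.
Proof. by rewrite /bad orbC. Qed.

(** At most [K] rows in one direction leave at most [2 ^ K] in the other, by transposition. *)
Lemma poor_not_bad K f A i (R : seq nat) j :
  nrows A (fun w => f w \notin R) <= K -> fib f i \subset A -> j \notin R -> ~~ bad K f i j.
Proof.
move=> rK iA jR; have le : nrows (fib f i) (mem (fib f j)) <= K.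
  by apply: leq_trans rK; apply: leq_nrows => // w; rewrite !inE => /eqP->.
rewrite /bad negb_or -!leqNgt; apply/andP; split.
  by apply: leq_trans le (ltnW (ltn_expl _ _)).
by apply: leq_trans (nrows_transpose _ _) _; rewrite leq_exp2l.
Qed.

(** At most [K] rows outside the exceptional fibres, times at most [2 ^ K] for each of the at most
    [K] exceptional fibres that are not bad. *)
Definition class_bound K := K * (2 ^ K) ^ K.

Lemma nrows_good_at K f i : poor K f (fib f i) ->
  nrows (fib f i) (good_at K f i) <= class_bound K.
Proof.
case=> R sR rK.
pose Q0 : pred 'I_n := fun w => f w \notin R.
(* The exceptional fibres that are not bad are added one at a time. *)
pose Q (L : seq nat) : pred 'I_n := fun w => has (fun j => ~~ bad K f i j && (f w == j)) L.
have QL L : nrows (fib f i) (predU Q0 (Q L)) <= K * (2 ^ K) ^ size L.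
  elim: L => [|j L IH].
    by rewrite muln1; apply: leq_trans rK; apply: leq_nrows => // w; rewrite /= orbF.
  pose Qj : pred 'I_n := fun w => ~~ bad K f i j && (f w == j).
  apply: (@leq_trans (nrows (fib f i) (predU Qj (predU Q0 (Q L))))).
    by apply: leq_nrows => // w; rewrite /= /Qj orbCA.
  apply: leq_trans (nrows_or _ _ _) _; rewrite /= expnS mulnCA; apply: leq_mul => //.
  case: (boolP (bad K f i j)) => bij.
    apply: (@leq_trans (nrows (fib f i) pred0)).
      by apply: leq_nrows => // w; rewrite /Qj bij.
    apply: leq_trans (_ : 1 <= _); last by rewrite expn_gt0.
    rewrite /nrows -(cards1 (set0 : {set 'I_n})); apply/subset_leq_card/subsetP.
    by move=> _ /imsetP[u _ ->]; rewrite inE; apply/eqP/setP => w; rewrite !inE andbF.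
  move: bij; rewrite /bad negb_or -!leqNgt => /andP[le _]; apply: leq_trans le.
  by apply: leq_nrows => // w /andP[_ fw]; rewrite /= inE.
apply: (@leq_trans (nrows (fib f i) (predU Q0 (Q R)))).
  apply: leq_nrows => // w gw; rewrite /= /Q0 /Q; case: (boolP (f w \in R)) => //= wR.
  by apply/hasP; exists (f w); rewrite // eqxx andbT.
apply: leq_trans (QL R) _.
by rewrite leq_mul2l leq_pexp2l ?orbT ?expn_gt0.
Qed.

Lemma sigpartP K f : partition (sigpart K f) [set: 'I_n].
Proof. exact: preim_partitionP. Qed.

Lemma sigpart_sig K f X u v : finer X (sigpart K f) ->
  pblock X u = pblock X v -> sig K f u = sig K f v.
Proof. by move=> fX /fX /eqP; rewrite pblock_preim => /eqP. Qed.

Lemma card_pieces K f X i : poor K f (fib f i) -> finer (sigpart K f) X ->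
  #|pblock X @: fib f i| <= class_bound K.
Proof.
move=> pi fX; apply: leq_trans (nrows_good_at pi).
apply: leq_card_imset_factor => u v; rewrite !inE => /eqP ui /eqP vi e.
by apply: fX; apply/eqP; rewrite pblock_preim /sig ui vi e.
Qed.

(** Equal signatures allow replacing one endpoint, then the other, since badness is symmetric; the
    order is constant because [f] is monotone. *)
Lemma homog_pieces K f X u v : {homo f : x y / x <= y} ->
  partition X [set: 'I_n] -> finer X (sigpart K f) ->
  f u != f v -> ~~ bad K f (f u) (f v) -> homog E (pblock X u) (pblock X v).
Proof.
move=> mf pX fX uv nb.
have Euv a b : a \in pblock X u -> b \in pblock X v ->
    [/\ f a = f u, f b = f v & E a b = E u v].
  rewrite !mem_pblock_setT // => /eqP/(sigpart_sig fX) [ea /esym] +.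
  move=> + /eqP/(sigpart_sig fX) [eb /esym].
  rewrite -ea -eb => /row_eqP ra /row_eqP rb; split=> //.
  rewrite ra ?/good_at -?eb // sE rb; first by rewrite sE.
  by rewrite /good_at bad_sym.
rewrite /homog; apply/andP; split.
  apply/orP; case Euv0: (E u v); [left|right];
    apply/forall_inP => a au; apply/forall_inP => b bv;
    by have [_ _ ->] := Euv a b au bv; rewrite Euv0.
have lt (a b : 'I_n) : f a < f b -> olt a b.
  by rewrite /olt !ltnNge; apply: contra; exact: mf.
apply/orP; move: uv; rewrite neq_ltn => /orP[] uv; [left|right];
  apply/forall_inP => a au; apply/forall_inP => b bv; apply: lt;
  by have [-> -> _] := Euv a b au bv.
Qed.

(** Red edges lead to the own fibre of [g] or to at most [K] exceptional ones; each is covered by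
    two fibres of [f] with at most [class_bound K] pieces each. *)
Definition tww_bound K := K.+1 * (2 * class_bound K).

Lemma red_deg_between K f g X :
  {homo g : x y / x <= y} ->
  (forall i, poor K f (fib f i)) -> (forall j, poor K g (fib g j)) ->
  (forall j, exists i i', fib g j \subset fib f i :|: fib f i') ->
  partition X [set: 'I_n] -> finer X (sigpart K g) -> finer (sigpart K f) X ->
  red_deg_le E X (tww_bound K).
Proof.
move=> mg pf pg fg pX Xg fX; apply/forallP => A; apply/implyP => AX.
have [u Au] := partition_ex pX AX.
have [R sR rK] := pg (g u).
apply: (@leq_trans #|\bigcup_(j <- g u :: R | predT j) (pblock X @: fib g j)|); last first.
  apply: leq_trans (leq_card_bigcup_const (c := 2 * class_bound K) _ _) _.
    move=> j _; have [i [i' sub]] := fg j.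
    apply: leq_trans (subset_leq_card (imsetS (pblock X) sub)) _.
    rewrite imsetU mul2n -addnn; apply: leq_trans (leq_card_setU _ _) _.
    by apply: leq_add; apply: card_pieces.
  by rewrite count_predT leq_mul2r /= ltnS sR orbT.
apply/subset_leq_card/subsetP => B; rewrite inE => /and3P[BX BA nh].
have [v Bv] := partition_ex pX BX.
have vR : g v \in g u :: R.
  apply: contraR nh; rewrite inE negb_or eq_sym => /andP[uv vR].
  by rewrite Au Bv; apply: (homog_pieces mg pX Xg uv); exact: poor_not_bad rK _ vR.
elim: (g u :: R) vR => // j L IH; rewrite inE big_cons inE => /orP[/eqP vj|/IH->]; last exact: orbT.
by rewrite Bv imset_f // inE vj.
Qed.

Lemma sigpart_coarsen K f g :
  (forall u v, f u = f v -> g u = g v) -> finer (sigpart K f) (sigpart K g).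
Proof.
move=> fg u v /eqP; rewrite pblock_preim => /eqP[fuv]; rewrite -fuv => /row_eqP ruv.
apply/eqP; rewrite pblock_preim /sig -(fg u v fuv) xpair_eqE eqxx /=; apply/eqP/row_eqP => w.
rewrite /good_at => gw; apply: ruv; move: gw; rewrite /good_at; apply: contra.
have sub x : fib f (f x) \subset fib g (g x).
  by apply/subsetP => y; rewrite !inE => /eqP/fg ->.
have mem_sub x y : y \in fib f (f x) -> y \in fib g (g x) by apply/subsetP.
by case/orP=> lt; apply/orP; [left|right]; apply: leq_trans lt _;
  apply: leq_nrows (sub _) (mem_sub _).
Qed.

Lemma poor_comp K f (h : nat -> nat) A : poor K f A -> poor K (h \o f) A.
Proof.
case=> R sR rK; exists (map h R); first by rewrite size_map.
by apply: leq_trans rK; apply: leq_nrows => // w; apply: contra => /(map_f h).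
Qed.

Lemma poor_sub K f A B : B \subset A -> poor K f A -> poor K f B.
Proof. by move=> BA [R sR rK]; exists R => //; apply: leq_trans rK; exact: leq_nrows. Qed.

(* The intervals are the fibres of [f], some of which may be empty. *)
Definition division K f m :=
  [/\ {homo f : x y / x <= y}, forall u, f u < m & forall i, poor K f (fib f i)].

Lemma merge_division K f m i : i <= m -> division K f m.+2 ->
  poor K f (fib f i :|: fib f i.+1) ->
  division K (unbump i \o f) m.+1 /\
  forall j, exists i1 i2, fib (unbump i \o f) j \subset fib f i1 :|: fib f i2.
Proof.
move=> im [mf fm pf] pi.
(* [unbump i] sends [i] and [i.+1] to [i] and closes the gap above them. *)
have fibE j : fib (unbump i \o f) j \subset
    if j == i then fib f i :|: fib f i.+1 else fib f (bump i j) :|: fib f (bump i j).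
  apply/subsetP => u; rewrite !inE /unbump /bump /= => /eqP uj.
  case: eqP => ij; rewrite !inE; lia.
split; last first.
  move=> j; have := fibE j; case: eqP => _ sub; first by exists i, i.+1.
  by exists (bump i j), (bump i j).
split=> [x y xy|u|j].
- by have := mf x y xy; rewrite /= /unbump; lia.
- by have := fm u; rewrite /= /unbump; lia.
- have := fibE j; case: eqP => [_ sub|_ sub]; apply: poor_sub sub _.
    exact: poor_comp.
  by rewrite setUid; apply: poor_comp.
Qed.

Lemma tower_of_merges K : 0 < K ->
  (forall f m, division K f m.+2 ->
     exists2 i, i <= m & poor K f (fib f i :|: fib f i.+1)) ->
  exists2 P : {set {set 'I_n}}, #|P| <= 1 & tower E (tww_bound K) P.
Proof.
move=> K0 merge.
have down m f : division K f m -> tower E (tww_bound K) (sigpart K f) ->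
    exists2 g, division K g 1 & tower E (tww_bound K) (sigpart K g).
  elim: m f => [|[|m] IH] f div tf.
  - by exists f => //; case: div => mf fm pf; split=> // u; exact: leq_trans (fm u) _.
  - by exists f.
  have [i im pi] := merge _ _ div.
  have [div' fg] := merge_division im div pi.
  apply: (IH _ div'); case: div => mf fm pf; case: div' => mg gm pg.
  apply: (tower_coarsen _ _ _ tf) => [|||R pR Rg fR]; try exact: sigpartP.
    by apply: sigpart_coarsen => u v /= ->.
  exact: red_deg_between mg pf pg fg pR Rg fR.
(* Start: every fibre has at most one vertex, hence at most one row. *)
pose f0 : 'I_n -> nat := val.
have single A : A \in sigpart K f0 -> #|A| = 1.
  move=> /(partition_ex (sigpartP _ _))[u ->]; apply/eqP/cards1P; exists u.
  apply/setP => w; rewrite inE mem_pblock_setT ?sigpartP // pblock_preim.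
  by apply/eqP/eqP => [[/val_inj]|->].
have div0 : division K f0 n.
  split=> [//|u|i]; first exact: ltn_ord.
  exists [::] => //; apply: leq_trans K0.
  apply: (@leq_trans #|fib f0 i|); first exact: leq_imset_card.
  apply/card_le1_eqP => u v; rewrite !inE => /eqP ui /eqP vi.
  by apply: ord_inj; rewrite [LHS]vi [RHS]ui.
have t0 : tower E (tww_bound K) (sigpart K f0).
  case: (div0) => mf _ pf; apply: tower_last => //; first exact: sigpartP.
  apply: (red_deg_between mf pf pf) => //; last exact: sigpartP.
  by move=> j; exists j, j; exact: subsetUl.
have [g [mg g1 pg] tg] := down _ _ div0 t0.
have [z _|no] := pickP (fun _ : 'I_n => true); last first.
  exists (sigpart K g) => //.
  suff -> : sigpart K g = set0 by rewrite cards0.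
  apply/setP => A; rewrite inE.
  by apply/negP => /(partition_ex (sigpartP _ _))[u]; have := no u.
(* A single interval may still consist of several pieces, but of at most [class_bound K], so every
   coarser partition has small red degree. *)
pose P1 := preim_partition (fun _ : 'I_n => tt) [set: 'I_n].
have pP1 : partition P1 [set: 'I_n] by exact: preim_partitionP.
exists P1.
  rewrite (partition_imset_pblock pP1); apply/card_le1_eqP => _ _ /imsetP[u _ ->] /imsetP[v _ ->].
  by apply/eqP; rewrite pblock_preim.
apply: (tower_coarsen pP1 (sigpartP K g) _ tg) => [u v _|R pR _ gR].
  by apply/eqP; rewrite pblock_preim.
apply/forallP => A; apply/implyP => _; apply: (@leq_trans #|R|).
  by apply/subset_leq_card/subsetP => B; rewrite inE => /andP[].
rewrite (partition_imset_pblock pR).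
have -> : [set: 'I_n] = fib g 0 by apply/setP => u; have := g1 u; rewrite !inE; case: (g u).
apply: leq_trans (card_pieces (pg 0) gR) _.
by rewrite /tww_bound mulnA leq_pmull.
Qed.

End RowCounts.

(** * The runner survives when no pair of intervals is poor *)

Section RunnerOnRichDivision.
Variables (n : nat) (E : rel 'I_n) (k K m : nat) (f : 'I_n -> nat).
Hypotheses (mf : {homo f : x y / x <= y}) (fm : forall u, f u < m.+2).
Implicit Types (u v w : 'I_n) (S : {set 'I_n}) (C : cutstate n).

Definition uncut S i := forall s, s \in S -> f s != i /\ f s != i.+1.

Definition fib2 i := fib f i :|: fib f i.+1.

Lemma fib2_simS S i u v : uncut S i -> u \in fib2 i -> v \in fib2 i -> simS S u v.
Proof.
move=> cut; rewrite !inE => ui vi; apply/simSP; right=> s /cut[s1 s2] /andP[].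
rewrite /minn /maxn; case: ifP => _ /mf h1 /mf h2; lia.
Qed.

Definition near_cuts S : seq nat := flatten [seq [:: (f s).-1; f s; (f s).+1] | s <- enum S].

Lemma near_cutsP S s j : s \in S -> j <= (f s).+1 -> f s <= j.+1 -> j \in near_cuts S.
Proof.
move=> sS js sj; apply/flattenP; exists [:: (f s).-1; f s; (f s).+1].
  by apply/mapP; exists s; rewrite // mem_enum.
by rewrite !inE; lia.
Qed.

(** Neither the interval of [w] nor its neighbours are cut, so the pair starting there is uncut; the
    last interval [m.+1] uses the pair ending there. *)
Lemma uncut_fib2 S w : f w \notin near_cuts S ->
  exists i, [/\ i <= m, uncut S i & w \in fib2 i].
Proof.
move=> wS; have no s : s \in S -> f w <= (f s).+1 -> f s <= (f w).+1 -> False.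
  by move=> sS h1 h2; move/negP: wS; apply; exact: near_cutsP sS h1 h2.
have fw := fm w; case: (leqP (f w) m) => wm; [exists (f w)|exists m]; split=> //.
- by move=> s /no; lia.
- by rewrite !inE eqxx.
- by move=> s /no; lia.
- by rewrite !inE; lia.
Qed.

Hypothesis kK : 3 * k < K.

Lemma size_near_cuts S : #|S| <= k -> size (near_cuts S) <= K.
Proof.
move=> cS; apply: leq_trans (ltnW kK); apply: (@leq_trans (3 * #|S|)); last by rewrite leq_mul2l cS.
rewrite cardE /near_cuts; elim: (enum S) => //= s L IH; lia.
Qed.

Lemma rich_nrows S i : #|S| <= k -> ~ poor E K f (fib2 i) ->
  K < nrows E (fib2 i) (fun w => f w \notin near_cuts S).
Proof.
move=> cS rich; rewrite ltnNge; apply/negP => le; apply: rich.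
by exists (near_cuts S) => //; exact: size_near_cuts.
Qed.

Hypothesis rich : forall i, i <= m -> ~ poor E K f (fib2 i).

(** Pigeonhole: more than [K] rows away from the cuts, but at most [K] classes. *)
Lemma differing_rows (T : finType) (p : 'I_n -> T) S i : #|T| <= K -> #|S| <= k -> i <= m ->
  exists u v w, [/\ u \in fib2 i, v \in fib2 i, p u = p v, E u w != E v w
                  & f w \notin near_cuts S].
Proof.
move=> cT cS im; have := rich_nrows cS (rich im).
set Q := fun w => _.
case: (boolP [exists u in fib2 i, exists v in fib2 i, exists w,
          [&& p u == p v, E u w != E v w & Q w]]).
  case/exists_inP => u ui /exists_inP[v vi /existsP[w /and3P[/eqP puv Euv Qw]]] _.
  by exists u, v, w.
move=> none; rewrite ltnNge => /negP[]; apply: leq_trans cT.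
apply: leq_trans (max_card (mem (p @: fib2 i))); apply: leq_card_imset_factor => u v ui vi puv.
apply/row_eqP => w Qw; apply/eqP; apply: contraNT none => Euv.
apply/exists_inP; exists u => //; apply/exists_inP; exists v => //.
by apply/existsP; exists w; rewrite puv eqxx Euv.
Qed.

Lemma fib2_not_wisolated C i v : 0 < K -> i <= m -> uncut C.2 i -> v \in fib2 i ->
  ~ wisolated C v.
Proof.
move=> K0 im cut vi iso.
(* With one class and no cuts, this only says that the pair has two distinct vertices; they are
   joined at weight 0. *)
have [|||u [v' [w [ui v'i _ Euv _]]]] := @differing_rows unit (fun=> tt) set0 i.
- by rewrite card_unit.
- by rewrite cards0.
- exact: im.
have [x xv xi] : exists2 x, x != v & x \in fib2 i.
  case: (eqVneq u v) => uv; [exists v' => //|by exists u].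
  by apply: contra Euv => /eqP ->; rewrite uv.
by have /andP[_] := iso x xv; rewrite (fib2_simS cut vi xi).
Qed.

(* In a class of the announced partition, two vertices of the uncut pair of the runner
   have different neighbourhoods away from the cuts announced next; one of them is
   adjacent, after the flip, to a vertex of an uncut pair of the next state. *)
Lemma runner_survives C v : 0 < K -> owin E 1 k C v ->
  is_kcutflip E k C -> forall i, i <= m -> uncut C.2 i -> v \in fib2 i -> False.
Proof.
move=> K0 win; elim/owin_nested_ind: win => {}C {}v C' lC' IH [[p [F [_ hp]]] _] i im cut vi.
have stay v' j : wreach C 1 v v' -> j <= m -> uncut C'.2 j -> v' \in fib2 j -> False.
  case/IH => [iso|h] jm cut' v'j; first exact: fib2_not_wisolated K0 jm cut' v'j iso.
  exact: h lC' j jm cut' v'j.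
case: (boolP [forall s in C'.2, (f s != i) && (f s != i.+1)]) => [/forall_inP cut'|].
  apply: (stay v i (wr_refl _ _ _) im _ vi) => s /cut' /andP[s1 s2]; exact: conj.
case/forall_inPn => s sC' hit.
have [|||u [u' [w [ui u'i puu' Euu' wC']]]] := @differing_rows _ p C'.2 i.
- by rewrite card_ord; apply: leq_trans (ltnW kK); rewrite leq_pmull.
- by case: lC'.
- exact: im.
(* [u] and [u'] share a class, so the flip toggles both adjacencies to [w] or neither. *)
have [x xi xw] : exists2 x, x \in fib2 i & xorb (E x w) (F (p x) (p w)).
  move: Euu'; case: (boolP (xorb (E u w) (F (p u) (p w)))) => [h _|nu ne]; first by exists u.
  by exists u' => //; move: nu ne; rewrite puu'; case: (E u w); case: (E u' w); case: (F _ _).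
(* The cut [s] hits the pair and [w] is more than one interval away from [s], so [w] is outside the
   pair. *)
have nxw : x != w.
  apply: contraTneq xi => ->; rewrite !inE; apply: contra wC' => wi.
  apply: (near_cutsP sC'); lia.
have [j [jm cut' wj]] := uncut_fib2 wC'.
apply: (stay w j _ jm cut' wj).
have step : wreach C 1 x w.
  by apply: (wr_one nxw); [rewrite hp nxw|exact: wr_refl].
case: (eqVneq v x) => [->//|vx].
by apply: (wr_zero vx) step; exact: fib2_simS cut vi xi.
Qed.

End RunnerOnRichDivision.

Lemma ofw1_poor_pair G K (f : 'I_(og_n G) -> nat) m : ofw_le 1 G K -> {homo f : x y / x <= y} ->
  (forall u, f u < m.+2) ->
  exists2 i, i <= m & poor (@og_E G) (3 * K).+1 f (fib f i :|: fib f i.+1).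
Proof.
case=> k [kK [C [lC win]]] mf fm; apply: NNPP => none.
have rich i : i <= m -> ~ poor (@og_E G) (3 * K).+1 f (fib2 f i).
  by move=> im pi; apply: none; exists i.
have k3 : 3 * k < (3 * K).+1 by rewrite ltnS leq_mul2l.
(* Richness of the first pair yields a vertex away from the first cuts, where the runner starts. *)
have [|||_ [_ [w [_ _ _ _ wC]]]] :=
    @differing_rows _ _ _ _ _ _ k3 rich unit (fun=> tt) C.2 0 => //.
- by rewrite card_unit.
- by case: lC.
have [i [im cut wi]] := uncut_fib2 fm wC.
have [iso|w_win] := win w.
  exact: (fib2_not_wisolated mf k3 rich _ im cut wi).
exact: (runner_survives mf fm k3 rich _ w_win lC im cut wi).
Qed.

Lemma ofw1_tww G K : ofw_le 1 G K -> tww_le G (tww_bound (3 * K).+1).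
Proof.
move=> win; apply/tww_leP; apply: (tower_of_merges (@og_sym G)) => // f m [mf fm _].
exact: ofw1_poor_pair.
Qed.

Theorem mainTheorem12 (C : ograph -> Prop) :
  let P1 := exists d, forall G, C G -> tww_le G d in
  let P2 := forall r : nat, exists K, forall G, C G -> fw_le r G K in
  let P3 := exists K, forall G, C G -> fw_le 5 G K in
  let P4 := forall r : nat, exists K, forall G, C G -> ofw_le r G K in
  let P5 := exists K, forall G, C G -> ofw_le 1 G K in
  [/\ P1 <-> P2, P1 <-> P3, P1 <-> P4 & P1 <-> P5].
Proof.
move=> P1 P2 P3 P4 P5.
have P12 : P1 -> P2.
  by case=> d hd r; exists (flip_size (tower_parts r d)) => G /hd; exact: tww_fw.
have P14 : P1 -> P4.
  by case=> d hd r; exists (flip_size (tower_parts (2 * r + 1) d)) => G /hd; exact: tww_ofw.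
have P23 : P2 -> P3 by apply.
have P45 : P4 -> P5 by apply.
have P35 : P3 -> P5 by case=> K hK; exists (2 * K) => G /hK; exact: fw5_ofw1.
have P51 : P5 -> P1 by case=> K hK; exists (tww_bound (3 * K).+1) => G /hK; exact: ofw1_tww.
by split; split; tauto.
Qed.
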